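(* Let $k$ be a field, $\prec$ a term order on $k[X]=k[x_1,\dots,x_n]$ and $J\subset k[X]$ a monomial ideal. Let $S$ be any one of the schemes $\mathcal{S}t(J,\prec)$ (with $\prec$ reliable), $\mathcal{S}t_h(J,\prec)$ (with $\prec$ arbitrary), or $\mathcal{S}t(J/\tau,\prec)$ (with $\prec$ reliable and $\tau$ any list of sets of monomials), and let $\mathcal{A}\subset k[C]$ be its defining ideal. Then either $S$ is isomorphic to an affine space over $k$, or the origin of $S$ (the point corresponding to $J$) is a singular point of $S$. Moreover, for every integer $d\ge 0$, $S\cong \mathbb{A}^d$ if and only if $d=\mathrm{ed}(\mathcal{A})=\dim(\mathcal{A})$.
   Context: Strata. A term order is \emph{reliable} if for every monomial $X^\alpha$ the set of monomials $X^\beta\prec X^\alpha$ is finite. For a monomial $X^\alpha$ put $\mathrm{tail}(X^\alpha)=\{X^\beta : X^\beta\prec X^\alpha\}$ and $\mathrm{htail}(X^\alpha)=\{X^\beta: X^\beta\prec X^\alpha,\ |\beta|=|\alpha|\}$. Let $X^{\alpha_1},\dots,X^{\alpha_s}$ be the minimal monomial generators of $J$ and let $\tau=[\tau_1,\dots,\tau_s]$ be a list of sets of monomials. For each $i$ let $T_i$ be: $\mathrm{tail}(X^{\alpha_i})\setminus J$ in the case of $\mathcal{S}t(J,\prec)$; $\mathrm{htail}(X^{\alpha_i})\setminus J$ in the case of the homogeneous stratum $\mathcal{S}t_h(J,\prec)$; $\mathrm{tail}(X^{\alpha_i})\setminus(J\cup\tau_i)$ in the case of $\mathcal{S}t(J/\tau,\prec)$.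 All $T_i$ are finite. Introduce a set $C$ of new variables $c_{i\beta}$, one for each $i$ and each $X^\beta\in T_i$, and set $F_i=X^{\alpha_i}+\sum_{X^\beta\in T_i}c_{i\beta}X^\beta\in k[X,C]$, with leading monomial $X^{\alpha_i}$ (regarded as a polynomial in $X$ with coefficients in $k[C]$). For $i<j$ let $H_{ij}$ be a complete reduction of the $S$-polynomial of $F_i,F_j$ with respect to $\{F_1,\dots,F_s\}$ (division in the variables $X$ with coefficients in $k[C]$, so that no monomial in $X$ appearing in $H_{ij}$ lies in $J$). The ideal $\mathcal{A}\subset k[C]$ is generated by all coefficients in $k[C]$ of the monomials in $X$ of all the $H_{ij}$ (it is independent of the choice of reductions), and the stratum is the closed subscheme of the affine space $\mathbb{A}^{|C|}$ over $k$ defined by $\mathcal{A}$. The origin (all $c_{i\beta}=0$) is a point of it and corresponds to $J$. Embedding dimension and dimension. For $F\in k[C]$, $L(F)$ is its linear component, i.e. the sum of its terms of usual degree 1; $L(\mathcal{A})$ is the $k$-vector space spanned by $L(F)$, $F\in\mathcal{A}$. The embedding dimension is $\mathrm{ed}(\mathcal{A})=|C|-\dim_k L(\mathcal{A})$ and $\dim(\mathcal{A})$ is the Krull dimension of $k[C]/\mathcal{A}$. *)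

(* Defs.v *)
From HB Require Import structures.
From mathcomp Require Import all_boot all_order all_algebra.
From mathcomp Require Import finmap.
From mathcomp Require Import boolp classical_sets cardinality.
From mathcomp Require Import ssrcomplements mpoly.

Set Implicit Arguments.
Unset Strict Implicit.
Unset Printing Implicit Defensive.

Import GRing.Theory.
Local Open Scope ring_scope.
Local Open Scope quotient_scope.
Local Open Scope classical_set_scope.

Section Ideals.
Variable R : comPzRingType.
Implicit Types (I P G : set R).

Definition is_ideal I :=
  [/\ I 0, forall x y, I x -> I y -> I (x + y) & forall a x, I x -> I (a * x)].

Definition ideal_gen G : set R :=
  [set x | forall I, is_ideal I -> G `<=` I -> I x].

Lemma ideal_gen_ideal G : is_ideal (ideal_gen G).
Proof.
split=> [I [] // | x y Gx Gy I Ii GI | a x Gx I Ii GI];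
  have [_ ID IM] := Ii; [apply: ID | apply: IM].
- exact: Gx.
- exact: Gy.
- exact: Gx.
Qed.

Definition is_prime P :=
  [/\ is_ideal P, ~ P 1 & forall x y, P (x * y) -> P x \/ P y].

Definition is_maximal P :=
  [/\ is_ideal P, ~ P 1 &
      forall I, is_ideal I -> ~ I 1 -> P `<=` I -> I `<=` P].

Definition noetherian :=
  forall I, is_ideal I -> exists s : seq R, I = ideal_gen [set` s].

Definition prime_chain d (P : 'I_d.+1 -> set R) :=
  (forall i, is_prime (P i)) /\ (forall i j : 'I_d.+1, (i < j)%N -> P i `<` P j).

Definition krull_dim d :=
  (exists P : 'I_d.+1 -> set R, prime_chain P) /\
  (forall e (P : 'I_e.+1 -> set R), prime_chain P -> (e <= d)%N).

Definition min_nb_gens I d :=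
  (exists2 s : seq R, I = ideal_gen [set` s] & size s = d) /\
  (forall s : seq R, I = ideal_gen [set` s] -> (d <= size s)%N).

(* A Noetherian ring with a unique maximal ideal, the minimal number of
   generators of that ideal being the Krull dimension. *)
Definition regular_local :=
  noetherian /\ exists m, [/\ is_maximal m,
    forall m', is_maximal m' -> m' = m &
    exists2 d, krull_dim d & min_nb_gens m d].

End Ideals.

Arguments noetherian : clear implicits.
Arguments krull_dim : clear implicits.
Arguments regular_local : clear implicits.

(* [f] exhibits [L] as the localization of [R] at the prime [P]: the elements
   outside [P] become invertible, every element of [L] is a fraction, and a / 1
   vanishes only if [a] is killed by some denominator. *)
Definition is_localization_at (R L : comPzRingType) (P : set R)
    (f : {rmorphism R -> L}) :=
  [/\ forall s, ~ P s -> exists v, f s * v = 1,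
      forall y, exists a s, ~ P s /\ y * f s = f a &
      forall a, f a = 0 -> exists s, ~ P s /\ s * a = 0].

Definition regular_at (R : comPzRingType) (P : set R) :=
  exists (L : comPzRingType) (f : {rmorphism R -> L}),
    is_localization_at P f /\ regular_local L.

(* The library's [{ideal_quot _}] requires a proper ideal; [quotient G] is the
   quotient of [R] by the ideal generated by [G], with no side condition. *)
Section Quotient.
Variables (R : comNzRingType) (G : set R).

Definition idealb : {pred R} := fun x => `[< ideal_gen G x >].

Lemma idealbP x : reflect (ideal_gen G x) (x \in idealb).
Proof. exact: asboolP. Qed.

Lemma idealb_zmod_closed : zmod_closed idealb.
Proof.
have [I0 ID IM] := ideal_gen_ideal G.
split=> [|x y /idealbP Ix /idealbP Iy]; apply/idealbP => //.
by apply: ID => //; rewrite -mulN1r; apply: IM.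
Qed.

HB.instance Definition _ := GRing.isZmodClosed.Build R idealb idealb_zmod_closed.

Lemma idealbM a x : x \in idealb -> a * x \in idealb.
Proof.
by move=> /idealbP Ix; apply/idealbP; case: (ideal_gen_ideal G) => _ _; apply.
Qed.

Definition quotient := Quotient.quot idealb.

HB.instance Definition _ := GRing.Zmodule.on quotient.
HB.instance Definition _ := EqQuotient.on quotient.

Definition quot_one : quotient := \pi_quotient 1.
Definition quot_mul (x y : quotient) : quotient := \pi_quotient (repr x * repr y).

Let pi_eq (x y : R) : (\pi_quotient x == \pi_quotient y) = (x - y \in idealb).
Proof. by rewrite -Quotient.idealrBE. Qed.

Let pi_mulE (x y : R) : quot_mul (\pi x) (\pi y) = \pi_quotient (x * y).
Proof.
apply/eqP; rewrite pi_eq.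
set x' := repr _; set y' := repr _.
have hx : x' - x \in idealb by rewrite -pi_eq reprK.
have hy : y' - y \in idealb by rewrite -pi_eq reprK.
have -> : x' * y' - x * y = x' * (y' - y) + y * (x' - x).
  by rewrite !mulrBr [y * x']mulrC [y * x]mulrC addrA subrK.
by rewrite rpredD // idealbM.
Qed.

Let mulA : associative quot_mul.
Proof.
by elim/quotW=> x; elim/quotW=> y; elim/quotW=> z;
  rewrite (pi_mulE y z) (pi_mulE x y) (pi_mulE x) pi_mulE mulrA.
Qed.

Let mulC : commutative quot_mul.
Proof. by move=> x y; rewrite /quot_mul mulrC. Qed.

Let mul1 : left_id quot_one quot_mul.
Proof. by elim/quotW=> x; rewrite pi_mulE mul1r. Qed.

Let piD (x y : R) : \pi_quotient (x + y) = \pi x + \pi y.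
Proof. exact: (@Quotient.pi_add R idealb x y). Qed.

Let mulDl : left_distributive quot_mul +%R.
Proof.
by elim/quotW=> x; elim/quotW=> y; elim/quotW=> z;
  rewrite (pi_mulE x z) (pi_mulE y z) -(piD x y) -(piD (x * z)) pi_mulE mulrDl.
Qed.

HB.instance Definition _ :=
  GRing.Zmodule_isComPzRing.Build quotient mulA mulC mul1 mulDl.

Definition quot_proj (x : R) : quotient := \pi_quotient x.

Let quot_proj_zmod : zmod_morphism quot_proj.
Proof.
by move=> x y; apply/eqP; rewrite eq_sym subr_eq /quot_proj -piD subrK.
Qed.

Let quot_proj_monoid : monoid_morphism quot_proj.
Proof. by split=> // x y; rewrite /quot_proj -pi_mulE. Qed.

HB.instance Definition _ :=
  GRing.isZmodMorphism.Build R quotient quot_proj quot_proj_zmod.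
HB.instance Definition _ :=
  GRing.isMonoidMorphism.Build R quotient quot_proj quot_proj_monoid.

Lemma quot_proj_surj (y : quotient) : exists x, quot_proj x = y.
Proof. by exists (repr y); rewrite /quot_proj reprK. Qed.

Lemma quot_proj_eq0 x : quot_proj x = 0 <-> ideal_gen G x.
Proof.
rewrite -(rmorph0 quot_proj) /quot_proj.
split=> [/eqP|Gx]; first by rewrite pi_eq subr0 => /idealbP.
by apply/eqP; rewrite pi_eq subr0; apply/idealbP.
Qed.

End Quotient.

Section AffineSubschemes.
Variables (k : fieldType) (N : nat) (A : set {mpoly k[N]}).

(* [Spec k[C]/A] is isomorphic to affine d-space over [Spec k]: since both
   schemes are affine, this is an isomorphism of k-algebras. *)
Definition iso_affine_space d :=
  exists phi : {rmorphism quotient A -> {mpoly k[d]}},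
    bijective phi /\ (forall c : k, phi (quot_proj A c%:MP) = c%:MP).

Definition origin_ideal : set (quotient A) :=
  [set quot_proj A f | f in [set f : {mpoly k[N]} | f.@[fun=> 0] = 0]].

Definition origin_singular := ~ regular_at origin_ideal.

Definition linear_part (f : {mpoly k[N]}) : {mpoly k[N]} := pihomog mdeg 1 f.

End AffineSubschemes.

Definition lin_span (K : fieldType) (V : lmodType K) (S : set V) : set V :=
  [set v | forall W : set V, W 0 -> (forall a u w, W u -> W w -> W (a *: u + w)) ->
     S `<=` W -> W v].

Definition has_dim (K : fieldType) (V : lmodType K) (W : set V) (r : nat) :=
  exists b : 'I_r -> V, (forall i, W (b i)) /\
    (forall v, W v -> exists! c : {ffun 'I_r -> K}, v = \sum_i c i *: b i).

Definition emb_dim (k : fieldType) N (A : set {mpoly k[N]}) (d : nat) :=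
  exists2 r, has_dim (lin_span (@linear_part k N @` A)) r & (d + r = N)%N.

Section Monomials.
Variables (k : fieldType) (n : nat).
Implicit Types (J : set {mpoly k[n]}) (prec : rel 'X_{1..n}).

Definition monomial_ideal J :=
  exists M : set 'X_{1..n}, J = ideal_gen [set ('X_[m] : {mpoly k[n]}) | m in M].

Definition minimal_generators s J (alpha : 'I_s -> 'X_{1..n}) :=
  J = ideal_gen [set ('X_[alpha i] : {mpoly k[n]}) | i in setT] /\
  (forall i, ~ ideal_gen [set ('X_[alpha j] : {mpoly k[n]}) | j in [set j | j != i]]
                 'X_[alpha i]).

(* [prec] is the strict order. *)
Definition term_order prec :=
  [/\ irreflexive prec, transitive prec,
      forall a b, a != b -> prec a b || prec b a,
      forall a b c, prec a b -> prec (a + c)%MM (b + c)%MM &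
      forall a, a != 0%MM -> prec 0%MM a].

Definition reliable prec := forall a, finite_set [set b | prec b a].

Inductive stratum_kind (s : nat) :=
  | Full
  | Homogeneous
  | Relative of 'I_s -> set 'X_{1..n}.

Definition admissible prec s (K : stratum_kind s) : Prop :=
  if K is Homogeneous then True else reliable prec.

Definition tail prec (a : 'X_{1..n}) : set 'X_{1..n} := [set b | prec b a].

Definition htail prec (a : 'X_{1..n}) : set 'X_{1..n} :=
  [set b | prec b a /\ mdeg b = mdeg a].

Section Stratum.
Variables (prec : rel 'X_{1..n}) (J : set {mpoly k[n]}) (s : nat).
Variables (alpha : 'I_s -> 'X_{1..n}) (K : stratum_kind s).

Definition mon_in : set 'X_{1..n} := [set b | J 'X_[b]].

Definition tail_set (i : 'I_s) : set 'X_{1..n} :=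
  match K with
  | Full => tail prec (alpha i) `\` mon_in
  | Homogeneous => htail prec (alpha i) `\` mon_in
  | Relative tau => tail prec (alpha i) `\` (mon_in `|` tau i)
  end.

Lemma finite_tail_set i : admissible prec K -> finite_set (tail_set i).
Proof.
have fin_deg d : finite_set [set b : 'X_{1..n} | mdeg b = d].
  apply: (@sub_finite_set _ _ [set bmnm b | b in [set: 'X_{1..n < d.+1}]]).
    by move=> b /= db; have lt : (mdeg b < d.+1)%N; [rewrite db | exists (BMultinom lt)].
  exact/finite_image/finite_finset.
rewrite /tail_set /admissible; case: K => [||tau] rel; apply: finite_setD.
- exact: rel.
- by apply: sub_finite_set (fin_deg (mdeg (alpha i))) => b [].
- exact: rel.
Qed.

(* [fset_set] returns the finite set with the same elements only because of
   [finite_tail_set]. *)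
Definition stratum_var : finType := {i : 'I_s & fset_set (tail_set i)}.

Definition nvars : nat := #|stratum_var|.

(* Polynomials in X with coefficients in k[C]. *)
Definition genpoly := {mpoly {mpoly k[nvars]}[n]}.

Definition coeff_var (i : 'I_s) (b : fset_set (tail_set i)) : {mpoly k[nvars]} :=
  'X_(enum_rank (Tagged (fun i => fset_set (tail_set i)) b : stratum_var)).

Definition generic_gen (i : 'I_s) : genpoly :=
  'X_[alpha i] + \sum_(b : fset_set (tail_set i)) coeff_var b *: 'X_[val b].

(* All leading coefficients are 1. *)
Definition spoly (i j : 'I_s) : genpoly :=
  let l := mlcm (alpha i) (alpha j) in
  'X_[(l - alpha i)%MM] * generic_gen i - 'X_[(l - alpha j)%MM] * generic_gen j.

Inductive reduces (g : genpoly) : genpoly -> Prop :=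
  | reduces_refl : reduces g g
  | reduces_step h m i : reduces g h -> m \in msupp h -> (alpha i <= m)%MM ->
      reduces g (h - (h@_m *: 'X_[(m - alpha i)%MM]) * generic_gen i).

Definition complete_reduction (g h : genpoly) :=
  reduces g h /\ (forall m, m \in msupp h -> ~ J 'X_[m]).

Definition stratum_ideal (H : 'I_s -> 'I_s -> genpoly) : set {mpoly k[nvars]} :=
  ideal_gen [set c | exists (i j : 'I_s) m, (i < j)%N /\ c = (H i j)@_m].

End Stratum.
End Monomials.

Arguments spoly {k n} prec J {s} alpha K i j.
Arguments complete_reduction {k n} prec J {s} alpha K g h.
Arguments stratum_ideal {k n} prec J {s} alpha K H.
Arguments Full {n s}.
Arguments Homogeneous {n s}.

(* Main.v *)
Require Import Defs.
From HB Require Import structures.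
From mathcomp Require Import all_boot all_order all_algebra.
From mathcomp Require Import finmap.
From mathcomp Require Import boolp classical_sets cardinality.
From mathcomp Require Import ssrcomplements mpoly.

(** The coordinate ring of a stratum is graded by Z^n: giving the parameter
    attached to alpha_i and beta the weight alpha_i - beta makes every generic
    generator homogeneous of weight alpha_i when x_j has weight e_j.
    S-polynomials and their reductions stay homogeneous, so A is a homogeneous
    ideal ([reduces_invariant], [wcomp_ideal_gen]).  The term order makes all
    parameter weights positive: their sums never vanish.  Setting all parameters
    to zero turns the generic generators into monomials, whose S-polynomials are
    zero, so A has no constant terms.  The theorem holds for every such ideal A
    of k[C] ([graded_affine_or_singular]).

    Choose parameters y_1, ..., y_e that form a basis of the linear forms modulo
    L(A).  Any other parameter v agrees, up to a linear form in the y_j, with the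
    linear part of some F in A, and F may be replaced by its component of weight
    w(v).  The nonlinear monomials of that component involve only parameters of
    weight smaller than w(v), because positive weights add up to w(v) in each of
    them.  By induction on the weight, every parameter is modulo A a polynomial in
    the y_j ([elim_var]).  Hence k[y_1, ..., y_e] maps onto k[C]/A, and the kernel
    lies in the square of the ideal (y_1, ..., y_e), since the y_j are independent
    modulo L(A) ([elim_map_surj], [elim_map_ker]).  Here e = ed(A)
    ([emb_dimE]).

    If the kernel is zero, the stratum is an affine space of dimension e.
    Otherwise prime chains of k[C]/A, or of any localization, pull back to prime
    chains of k[y] above a nonzero ideal; they can be extended by the zero ideal,
    so their length is smaller than e ([prime_chain_lt_kernel]).  The maximal
    ideal at the origin still needs e generators, because the kernel has order at
    least two ([gens_ge_dim]); so the local ring is not regular.  Conversely, if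
    k[C]/A is isomorphic to k[x_1, ..., x_d], the origin becomes a rational point,
    whose ideal has d generators, so e <= d, while d <= e by comparing dimensions
    ([iso_affine_dim]).

    The bound on prime chains in a polynomial ring comes from algebraic
    dependence: along a chain of length e > d pick an element of each prime
    outside the preceding one; these e > d polynomials satisfy a polynomial
    relation ([algebraic_dependence]), whose lexicographically smallest monomial
    would have to lie in the last prime with a nonzero constant as coefficient
    ([chain_independence]). *)

Set Implicit Arguments.
Unset Strict Implicit.
Unset Printing Implicit Defensive.

Import GRing.Theory.
Local Open Scope ring_scope.
Local Open Scope classical_set_scope.

Local Notation at0 f := (f.@[fun=> 0]).

(** * Ideals of a commutative ring *)

Section Ideals.
Variable R : comPzRingType.
Implicit Types I P : set R.

Lemma ideal_opp I x : is_ideal I -> I x -> I (- x).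
Proof. by move=> [_ _ IM] Ix; rewrite -mulN1r; apply: IM. Qed.

Lemma ideal_sub I x y : is_ideal I -> I x -> I y -> I (x - y).
Proof. by move=> II Ix Iy; have [_ ID _] := II; apply: ID => //; apply: ideal_opp. Qed.

Lemma ideal_sum I (T : finType) (Q : pred T) (F : T -> R) :
  is_ideal I -> (forall t, Q t -> I (F t)) -> I (\sum_(t | Q t) F t).
Proof. by move=> [I0 ID _] IF; elim/big_ind: _. Qed.

Lemma ideal_gen_id I : is_ideal I -> ideal_gen I = I.
Proof.
move=> II; apply/seteqP; split=> [x Ix|x Ix J IJ]; first exact: Ix.
exact.
Qed.

Lemma prime_expr P x j : is_prime P -> P (x ^+ j) -> P x.
Proof.
move=> [_ P1 PM]; elim: j => [|j IH]; first by rewrite expr0.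
by rewrite exprS => /PM [].
Qed.

End Ideals.

(** * Algebraic dependence of polynomials *)

Section AlgebraicDependence.
Variables (k : fieldType) (d : nat).
Notation R := {mpoly k[d]}.

Definition deg_le (p : R) (D : nat) := forall m, m \in msupp p -> (mdeg m <= D)%N.

Lemma deg_le_prod (T : finType) (F : T -> R) (D : T -> nat) :
  (forall t, deg_le (F t) (D t)) -> deg_le (\prod_t F t) (\sum_t D t)%N.
Proof.
move=> FD; elim/big_ind2: _ => [m|x a y b ax yb m|t _]; last exact: FD.
  by rewrite msupp1 inE => /eqP ->; rewrite mdeg0.
move=> /msuppM_le /allpairsP[[u v] /= [ux vy ->]].
by rewrite mdegD leq_add ?ax ?yb.
Qed.

Lemma deg_leX p D j : deg_le p D -> deg_le (p ^+ j) (j * D).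
Proof.
move=> pD; have := @deg_le_prod 'I_j (fun=> p) (fun=> D) (fun=> pD).
by rewrite prodr_const sum_nat_const card_ord.
Qed.

(** The numerical input of the dependence argument: there are N^e products with
    exponents below N, all of total degree at most e * (N * D), and at most the
    left-hand number of monomials in d variables to express them. *)
Lemma box_card_gap e D : (d < e)%N -> exists N, ((e * (N * D)).+1 ^ d < N ^ e)%N.
Proof.
move=> de; pose N := ((e * D).+1 ^ d).+1; exists N; apply: (@leq_ltn_trans ((N * (e * D).+1) ^ d)).
  have [->|d0] := posnP d; first by rewrite !expn0.
  by rewrite leq_exp2r // mulnS [(e * _)%N]mulnCA -add1n leq_add.
by rewrite expnMn (@leq_trans (N ^ d.+1)) ?leq_pexp2l // expnSr ltn_pmul2l ?expn_gt0.
Qed.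

(** Proved by counting: the products of powers of the a_i with exponents below N
    live in a space of polynomials whose dimension grows like N^d only, so for
    large N they are linearly dependent. *)
Lemma algebraic_dependence e (a : 'I_e -> R) : (d < e)%N ->
  exists N (c : {ffun {ffun 'I_e -> 'I_N} -> k}), (exists t, c t != 0) /\
    \sum_t (c t)%:MP * \prod_i a i ^+ t i = 0.
Proof.
move=> de.
have [D aD] : exists D, forall i, deg_le (a i) D.
  exists (\max_i msize (a i))%N => i m /msize_mdeg_lt lt.
  by apply: ltnW; apply: (leq_trans lt); apply: leq_bigmax.
have [N gap] := box_card_gap D de.
pose T := {ffun 'I_e -> 'I_N}; pose N' := (e * (N * D)).+1.
pose T' := {ffun 'I_d -> 'I_N'}.
pose mon (t' : T') : 'X_{1..d} := [multinom (t' i : nat) | i < d].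
pose p (t : T) := \prod_i a i ^+ t i.
have pdeg t : deg_le (p t) (e * (N * D)).
  move=> m mp; rewrite (leq_trans (deg_le_prod (fun i => @deg_leX _ _ (t i) (aD i)) mp)) //.
  rewrite -[X in (_ <= X * _)%N]card_ord -sum_nat_const leq_sum // => i _.
  by rewrite leq_mul2r ltnW ?orbT.
(* A nonzero row of the left kernel of M, the matrix whose rows are the
   coefficient vectors of the products, is the relation sought. *)
pose M := \matrix_(i < #|{:T}|, j < #|{:T'}|) (p (enum_val i))@_(mon (enum_val j)).
have rk : (\rank M < #|{:T}|)%N.
  by rewrite (leq_ltn_trans (rank_leq_col _)) // !card_ffun !card_ord.
have ker0 : kermx M != 0 by rewrite kermx_eq0 /row_free neq_ltn rk.
have [i [j kij]] : exists i j, kermx M i j != 0.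
  apply: contrapT => /forallNP K0; case/eqP: ker0; apply/matrixP => i j.
  by have /forallNP/(_ j)/negP/negPn/eqP -> := K0 i; rewrite mxE.
exists N, [ffun t => kermx M i (enum_rank t)]; split.
  by exists (enum_val j); rewrite ffunE enum_valK.
apply/mpolyP => m; rewrite raddf_sum mcoeff0 /=.
case: (leqP (mdeg m) (e * (N * D))) => [mle|mgt]; last first.
  apply: big1 => t _; rewrite mcoeffCM memN_msupp_eq0 ?mulr0 //.
  by apply: contraL mgt => /pdeg; rewrite -leqNgt.
have mlt (l : 'I_d) : (m l < N')%N.
  by rewrite ltnS (leq_trans _ mle) // mdegE (bigD1 l) //= leq_addr.
pose t' : T' := [ffun l => Ordinal (mlt l)].
have mt' : m = mon t' by apply/mnmP => l; rewrite mnmE ffunE.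
have := mulmx_ker M; move/matrixP/(_ i (enum_rank t')); rewrite !mxE => KM.
rewrite -[RHS]KM (reindex (@enum_rank _)) /=; last by apply: onW_bij; apply: enum_rank_bij.
by apply: eq_bigr => t _; rewrite mcoeffCM ffunE !mxE !enum_rankK -mt'.
Qed.

End AlgebraicDependence.

(** * Krull dimension of a polynomial ring *)

Section KrullDimension.
Variables (k : fieldType) (d : nat).
Notation R := {mpoly k[d]}.

(** Elements picked along a chain of primes cannot be algebraically dependent.
    In a relation lying in P_j, divide out the smallest power of a_j: the
    quotient lies in P_j since a_j does not, and modulo a_j, which lies in
    P_(j+1), only the terms of minimal exponent in a_j survive.  Iterating
    isolates the lexicographically smallest term of the relation. *)
Lemma chain_independence e (P : 'I_e.+1 -> set R) (a : 'I_e -> R) N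
    (c : {ffun 'I_e -> 'I_N} -> k) :
  (forall i, is_prime (P i)) ->
  (forall i : 'I_e, P (widen_ord (leqnSn e) i) `<=` P (lift ord0 i)) ->
  (forall i, P (lift ord0 i) (a i) /\ ~ P (widen_ord (leqnSn e) i) (a i)) ->
  \sum_t (c t)%:MP * \prod_i a i ^+ t i = 0 -> forall t, c t = 0.
Proof.
move=> Pp PS Pa rel t0; apply/eqP; apply: contrapT => /negP ct0.
(* S collects the terms whose first j exponents are lexicographically minimal;
   the factors a_i with i < j have already been divided out. *)
have step j : (j <= e)%N -> exists S : {set {ffun 'I_e -> 'I_N}}, [/\
    exists t, t \in S, forall t, t \in S -> c t != 0,
    forall t u (i : 'I_e), t \in S -> u \in S -> (i < j)%N -> t i = u i &
    P (inord j) (\sum_(t in S) (c t)%:MP * \prod_(i < e | (j <= i)%N) a i ^+ t i)].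
  elim: j => [_|j IH je].
    exists (finset (fun t => c t != 0)); split=> //; first by exists t0; rewrite inE.
      by move=> t; rewrite inE.
    have [[P0 _ _] _ _] := Pp (inord 0).
    suff -> : \sum_(t in finset (fun t => c t != 0))
        (c t)%:MP * \prod_(i < e | (0 <= i)%N) a i ^+ t i = 0 by [].
    rewrite -[RHS]rel big_mkcond; apply: eq_bigr => t _; rewrite inE.
    by case: eqP => // ->; rewrite mpolyC0 mul0r.
  have [S [[t1 t1S] cS constS PSj]] := IH (ltnW je).
  pose i := Ordinal je.
  have wi : widen_ord (leqnSn e) i = inord j by apply/val_inj; rewrite /= inordK // ltnW.
  have li : lift ord0 i = inord j.+1 by apply/val_inj; rewrite /= inordK.
  pose t2 := [arg min_(t < t1 in S) (t i : nat)].
  have [t2S t2min] : t2 \in S /\ forall t, t \in S -> (t2 i <= t i)%N.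
    by rewrite /t2; case: arg_minnP.
  pose S' := finset (fun t => (t \in S) && (t i == t2 i)).
  exists S'; split.
  - by exists t2; rewrite inE t2S /=.
  - by move=> t; rewrite inE => /andP[/cS].
  - move=> t u l; rewrite !inE => /andP[tS /eqP ti] /andP[uS /eqP ui].
    rewrite ltnS leq_eqVlt => /orP[/eqP lj|]; last exact: constS.
    have -> : l = i by apply/val_inj.
    by rewrite ti ui.
  have [aP aN] := Pa i; rewrite wi in aN; rewrite li in aP.
  have [[_ QD QM] _ _] := Pp (inord j.+1).
  have sub := PS i; rewrite wi li in sub.
  pose tailprod (t : {ffun 'I_e -> 'I_N}) := \prod_(l < e | (j.+1 <= l)%N) a l ^+ t l.
  have splitprod (t : {ffun 'I_e -> 'I_N}) :
      \prod_(l < e | (j <= l)%N) a l ^+ t l = a i ^+ t i * tailprod t.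
    rewrite (bigD1 i) //=; congr (_ * _); apply: eq_bigl => l.
    by rewrite [(j < l)%N]ltn_neqAle -(inj_eq val_inj) /= eq_sym andbC.
  (* B is the relation in P_j divided by the common factor a_j ^ t2 j; its part
     rest is divisible by a_j. *)
  pose B := \sum_(t in S) (c t)%:MP * (a i ^+ (t i - t2 i) * tailprod t).
  have PB : P (inord j) B.
    have [_ _ prime] := Pp (inord j).
    have : P (inord j) (a i ^+ t2 i * B).
      suff -> : a i ^+ t2 i * B = \sum_(t in S) (c t)%:MP *
          \prod_(i < e | (j <= i)%N) a i ^+ t i by [].
      rewrite mulr_sumr; apply: eq_bigr => t tS.
      by rewrite splitprod mulrCA [a i ^+ _ * (_ * _)]mulrA -exprD subnKC ?t2min.
    by case/prime => // /(prime_expr (Pp _)).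
  pose rest := \sum_(t in S | t i != t2 i) (c t)%:MP * (a i ^+ (t i - t2 i) * tailprod t).
  have BE : B = \sum_(t in S') (c t)%:MP * tailprod t + rest.
    rewrite /B (bigID (fun t : {ffun 'I_e -> 'I_N} => t i == t2 i)) /=; congr (_ + _).
    by apply: eq_big => t; rewrite ?inE // => /andP[_ /eqP ->]; rewrite subnn mul1r.
  rewrite (_ : \sum_(t in S') _ = B - rest); last by rewrite BE addrK.
  have [IP _ _] := Pp (inord j.+1).
  apply: ideal_sub => //; first exact: sub.
  apply: ideal_sum => // t /andP[tS ne]; apply: (QM); rewrite mulrC; apply: (QM) => /=.
  have lt : (t2 i < t i)%N by rewrite ltn_neqAle eq_sym ne t2min.
  by rewrite -(subnSK lt) exprSr; apply: QM.
have [S [[t1 t1S] cS constS]] := step e (leqnn e).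
have St u : u \in S -> u = t1.
  by move=> uS; apply/ffunP => i; apply: constS.
rewrite (eq_bigl (pred1 t1)); last first.
  by move=> u /=; apply/idP/eqP => [/St|->].
rewrite big_pred1_eq big1 => [|i]; last by rewrite leqNgt ltn_ord.
rewrite mulr1 => Pc; have [[_ _ PM] P1 _] := Pp (inord e).
apply: P1; have := PM (c t1)^-1%:MP _ Pc.
by rewrite -mpolyCM mulVf ?cS.
Qed.

Lemma krull_dim_mpoly_le e (P : 'I_e.+1 -> set R) : prime_chain P -> (e <= d)%N.
Proof.
move=> [Pp Pi]; rewrite leqNgt; apply/negP => de.
have lt (i : 'I_e) : P (widen_ord (leqnSn e) i) `<` P (lift ord0 i) by apply: Pi.
have /choice[a Pa] : forall i : 'I_e, exists x,
    P (lift ord0 i) x /\ ~ P (widen_ord (leqnSn e) i) x.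
  move=> i; have [_ nsub] := lt i; apply: contrapT => no; apply: nsub => x Px.
  by apply: contrapT => nPx; apply: no; exists x.
have [N [c [[t ct] rel]]] := algebraic_dependence a de.
move/eqP: ct; apply; apply: (chain_independence Pp) Pa rel _ => i.
by have [] := lt i.
Qed.

(** The chain of the primes (x_0, ..., x_(i-1)): each is the kernel of the
    substitution of 0 for the variables of index below i, whose target is a
    domain. *)
Lemma krull_dim_mpoly_ge : exists P : 'I_d.+1 -> set R, prime_chain P.
Proof.
pose z (i : 'I_d.+1) := [tuple (if (j < i)%N then 0 else 'X_j : R) | j < d].
exists (fun i => [set f | f \mPo z i = 0]); split=> [i|i j ij].
  split.
  - split=> /= [|x y x0 y0|a x x0]; first by rewrite comp_mpoly0.
      by rewrite comp_mpolyD x0 y0 addr0.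
    by rewrite rmorphM /= x0 mulr0.
  - by rewrite /= comp_mpoly1 => /eqP; rewrite oner_eq0.
  - move=> x y /= /eqP; rewrite rmorphM mulf_eq0.
    by move=> /orP[] /eqP; [left|right].
split=> [f /= f0|sub].
  have -> : f \mPo z j = (f \mPo z i) \mPo z j.
    elim/mpolyind: f {f0} => [|c m p _ _ IH]; first by rewrite !comp_mpoly0.
    rewrite !comp_mpolyD !comp_mpolyZ IH; congr (_ *: _ + _).
    rewrite !comp_mpolyX rmorph_prod; apply: eq_bigr => l _ /=.
    rewrite rmorphXn /= !tnth_mktuple; case: (ltnP l i) => [li|_].
      by rewrite comp_mpoly0 (ltn_trans li ij).
    by rewrite comp_mpolyXU -tnth_nth tnth_mktuple.
  by rewrite f0 comp_mpoly0.
have id : (i < d)%N by rewrite (leq_trans ij) // -ltnS.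
have /sub : ('X_(Ordinal id) : R) \mPo z j = 0.
  by rewrite comp_mpolyXU -tnth_nth tnth_mktuple /= ij.
rewrite /= comp_mpolyXU -tnth_nth tnth_mktuple /= ltnn => /(congr1 (mcoeff U_(Ordinal id)));
by rewrite mcoeffXU mcoeff0 eqxx => /eqP; rewrite oner_eq0.
Qed.

End KrullDimension.

(** * Prime chains under quotients and localizations *)

Section FractionMaps.
Variables (R L : comPzRingType) (g : {rmorphism R -> L}).

(** Common to surjections and to localization maps: every element of the target
    is a fraction a / w with denominator invertible in the target.  This is what
    makes pullback of primes strictly monotone. *)
Definition fraction_map :=
  forall y, exists w a v, g w * v = 1 /\ y * g w = g a.

Lemma surjective_fraction_map : (forall y, exists x, g x = y) -> fraction_map.
Proof.
by move=> gs y; have [x <-] := gs y; exists 1, x, 1; rewrite rmorph1 !mulr1.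
Qed.

Lemma is_prime_preim P : is_prime P -> is_prime (g @^-1` P).
Proof.
move=> [[P0 PD PM] P1 Pp]; split=> [|/=|x y /=]; last by rewrite rmorphM => /Pp.
  split=> [|x y Px Py|a x Px] /=; first by rewrite rmorph0.
    by rewrite rmorphD; apply: PD.
  by rewrite rmorphM; apply: PM.
by rewrite rmorph1.
Qed.

Lemma prime_chain_preim d (P : 'I_d.+1 -> set L) :
  fraction_map -> prime_chain P -> prime_chain (fun i => g @^-1` P i).
Proof.
move=> gf [Pp Pi]; split=> [i|i j /Pi [sub nsub]]; first exact: is_prime_preim.
split=> [x /sub //|sub']; apply: nsub => y Py.
have [w [a [v [wv yw]]]] := gf y.
have [[_ _ PjM] _ _] := Pp j; have [[_ _ PiM] _ _] := Pp i.
have /sub' /= : (g @^-1` P j) a by rewrite /= -yw mulrC; apply: PjM.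
by rewrite -yw => /(PiM v); rewrite mulrC -mulrA wv mulr1.
Qed.

End FractionMaps.

(** A pulled back chain lies above the nonzero kernel, so the zero ideal of the
    domain k[x_1, ..., x_e] can be put below it. *)
Lemma prime_chain_lt_kernel (k : fieldType) e (L : comPzRingType)
    (g : {rmorphism {mpoly k[e]} -> L}) x d (P : 'I_d.+1 -> set L) :
  fraction_map g -> g x = 0 -> x != 0 -> prime_chain P -> (d < e)%N.
Proof.
move=> gf gx0 x0 /(prime_chain_preim gf) [Qp Qi].
pose Q (i : 'I_d.+2) :=
  if unlift ord0 i is Some j then g @^-1` P j else [set 0 : {mpoly k[e]}].
apply: (@krull_dim_mpoly_le k e d.+1 Q); split=> [i|i j].
  rewrite /Q; case: unliftP => [j _|_]; first exact: Qp.
  split.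
  - by split=> [//|y z -> ->|a y ->] /=; rewrite ?addr0 ?mulr0.
  - by move=> /= /eqP; rewrite oner_eq0.
  - by move=> y z /= /eqP; rewrite mulf_eq0 => /orP[] /eqP; [left|right].
rewrite /Q; case: (unliftP ord0 j) => [j' ->|-> //]; case: (unliftP ord0 i) => [i' ->|_ _].
  by rewrite !lift0 ltnS => /Qi.
have [[P0 _ _] _ _] := Qp j'; split=> [_ -> //|].
have xP : (g @^-1` P j') x by rewrite /= gx0; move: P0 => /=; rewrite rmorph0.
by move=> /(_ x xP) /= /eqP; apply/negP.
Qed.

(** * Linear parts and the number of generators at a point *)

Lemma mpoly_alg_ind (k : fieldType) N (P : {mpoly k[N]} -> Prop) :
  (forall c, P c%:MP) -> (forall i, P 'X_i) ->
  (forall f g, P f -> P g -> P (f + g)) -> (forall f g, P f -> P g -> P (f * g)) ->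
  forall f, P f.
Proof.
move=> PC PX PD PM; elim/mpolyind => [|c m p _ _ Pp]; first exact: PC.
apply: (PD) => //; rewrite -mul_mpolyC; apply: (PM) => //; rewrite mpolyXE_id.
elim/big_ind: _ => [||i _]; [exact: PC | exact: PM |].
elim: (m i) => [|j IH]; first exact: PC.
by rewrite exprS; apply: PM.
Qed.

Section LinearForms.
Variables (k : fieldType) (N : nat).
Notation R := {mpoly k[N]}.
Implicit Types f g : R.

Definition coefvec f : 'rV[k]_N := \row_i f@_U_(i).

Lemma meval_at0 f : at0 f = f@_0%MM.
Proof.
elim/mpolyind: f => [|c m p _ _ IH]; first by rewrite meval0 mcoeff0.
rewrite mevalD mevalZ IH mcoeffD mcoeffZ mcoeffX mevalX; congr (_ * _ + _).
have [->|m0] := eqVneq; first by apply: big1 => i _; rewrite mnm0E expr0.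
have [i mi] : exists i, m i != 0%N.
  apply: contrapT => /forallNP z; case/eqP: m0; apply/mnmP => i.
  by rewrite mnm0E; apply/eqP/negPn/negP/z.
by rewrite (bigD1 i) //= expr0n (negbTE mi) mul0r.
Qed.

Lemma coefvecE f i : coefvec f 0 i = at0 (f^`M(i)).
Proof. by rewrite mxE meval_at0 mcoeff_deriv mnm0E add0m. Qed.

Lemma coefvec_is_linear : linear coefvec.
Proof. by move=> a f g; apply/rowP => i; rewrite !mxE mcoeffD mcoeffZ. Qed.

HB.instance Definition _ :=
  GRing.isLinear.Build k R 'rV[k]_N *:%R coefvec coefvec_is_linear.

(** Taking linear parts at the origin is a derivation with values in k^N. *)
Lemma coefvecM f g : coefvec (f * g) = at0 f *: coefvec g + at0 g *: coefvec f.
Proof.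
apply/rowP => i; rewrite coefvecE mderivM mevalD !mevalM -!coefvecE addrC !mxE.
by rewrite [X in _ + X]mulrC.
Qed.

Lemma coefvecC c : coefvec c%:MP = 0.
Proof.
apply/rowP => i; rewrite !mxE mcoeffC.
by rewrite -mdeg_eq0 mdeg1 mulr0.
Qed.

Lemma coefvecX i : coefvec 'X_i = delta_mx 0 i.
Proof. by apply/rowP => j; rewrite !mxE eqxx mcoeffXU eq_sym. Qed.

Lemma at0X i : at0 ('X_i : R) = 0.
Proof. by rewrite mevalXU. Qed.

End LinearForms.

(** When the kernel of f has order at least two at the origin, f induces an
    isomorphism from the cotangent space of affine e-space at the origin to that
    of its image, so generators of the ideal of the image point need at least e
    elements.  The proof makes this concrete without forming the quotient: the
    elements f b / f w for which the linear part of b is a combination of those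
    of the numerators of s form an ideal, which contains s, hence all the f x_i;
    so all variables are such combinations.  Denominators are allowed in order to
    cover both a quotient ring and its local ring. *)
Lemma gens_ge_dim (k : fieldType) e (L : comPzRingType)
    (f : {rmorphism {mpoly k[e]} -> L}) (s : seq L) :
  (forall y, exists w a, at0 w != 0 /\ y * f w = f a) ->
  (forall a, f a = 0 -> coefvec a = 0) ->
  (forall y, y \in s -> exists w b, [/\ at0 w != 0, at0 b = 0 & y * f w = f b]) ->
  (forall i, ideal_gen [set` s] (f 'X_i)) ->
  (e <= size s)%N.
Proof.
move=> frac ker sM Xs.
have /choice[wb wbP] : forall j : 'I_(size s), exists wb : {mpoly k[e]} * {mpoly k[e]},
    [/\ at0 wb.1 != 0, at0 wb.2 = 0 & s`_j * f wb.1 = f wb.2].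
  by move=> j; have [w [b h]] := sM s`_j (mem_nth _ (ltn_ord j)); exists (w, b).
pose V := \matrix_(j < size s) coefvec (wb j).2.
pose I := [set y | exists w b, [/\ at0 w != 0, at0 b = 0, y * f w = f b &
  (coefvec b <= V)%MS]].
have II : is_ideal I.
  split=> [|x y [w [b [w0 b0 xw bV]]] [w' [b' [w'0 b'0 yw' b'V]]]|a y [w [b [w0 b0 yw bV]]]].
  - exists 1, 0; split; rewrite ?meval1 ?oner_eq0 ?meval0 ?rmorph0 ?mul0r //.
    by rewrite linear0 sub0mx.
  - exists (w * w'), (b * w' + b' * w); split.
    + by rewrite mevalM mulf_neq0.
    + by rewrite mevalD !mevalM b0 b'0 !mul0r addr0.
    + by rewrite rmorphD !rmorphM -xw -yw' mulrDl !mulrA [y * _ * _]mulrAC.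
    + rewrite linearD /= !coefvecM b0 b'0 !scale0r !add0r.
      by rewrite addmx_sub ?scalemx_sub.
  - have [u [c [u0 au]]] := frac a; exists (u * w), (c * b); split.
    + by rewrite mevalM mulf_neq0.
    + by rewrite mevalM b0 mulr0.
    + by rewrite !rmorphM -au -yw mulrACA.
    + by rewrite coefvecM b0 scale0r addr0 scalemx_sub.
have sI : [set` s] `<=` I.
  move=> y /= /(nthP 0) [j js <-]; have [w0 b0 yw] := wbP (Ordinal js).
  exists (wb (Ordinal js)).1, (wb (Ordinal js)).2; split=> //.
  by rewrite -(rowK (fun j => coefvec (wb j).2)) row_sub.
have full : row_full V.
  rewrite -sub1mx; apply/row_subP => i; rewrite rowE mulmx1.
  have [w [b [w0 b0 eq bV]]] := Xs i I II sI.
  have /ker : f ('X_i * w - b) = 0 by rewrite rmorphB rmorphM eq subrr.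
  rewrite linearB /= coefvecM at0X scale0r add0r coefvecX => /subr0_eq E.
  by have := scalemx_sub (at0 w)^-1 bV; rewrite -E scalerA mulVf // scale1r.
by move: full; rewrite /row_full => /eqP <-; apply: rank_leq_row.
Qed.

(** A matrix of maximal rank among those with all rows in W does the job, since
    adjoining any further vector of W would raise the rank. *)
Lemma linear_set_rowspace (k : fieldType) N (W : set 'rV[k]_N) :
  W 0 -> (forall a u w, W u -> W w -> W (a *: u + w)) ->
  exists B : 'M[k]_N, forall v, W v <-> (v <= B)%MS.
Proof.
move=> W0 Wl.
have Wsum (T : finType) (c : T -> k) (u : T -> 'rV_N) :
    (forall t, W (u t)) -> W (\sum_t c t *: u t).
  by move=> Wu; elim/big_rec: _ => // t x _ Wx; apply: Wl.
pose inW (B : 'M[k]_N) := forall i, W (row i B).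
have inWP B v : inW B -> (v <= B)%MS -> W v.
  by move=> BW /submxP [x ->]; rewrite mulmx_sum_row; apply: Wsum.
pose Q r := `[< exists2 B, inW B & \rank B = r >].
have exQ : exists r, Q r.
  by exists 0%N; apply/asboolP; exists 0; rewrite ?mxrank0 // => i; rewrite row0.
have ubQ r : Q r -> (r <= N)%N by move=> /asboolP[B _ <-]; apply: rank_leq_row.
case: (ex_maxnP exQ ubQ) => r /asboolP[B BW Br] max.
exists B => v; split=> [Wv|]; last exact: inWP.
have inS : inW (B + v)%MS.
  move=> i; have /sub_addsmxP [[x y] /= ->] := row_sub i (B + v)%MS.
  rewrite addrC [y]mx11_scalar mul_scalar_mx; apply: Wl => //.
  exact: inWP (submxMl _ _).
have := max _ (asboolT (ex_intro2 _ _ _ inS erefl)).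
rewrite -Br => le; rewrite (geq_leqif (mxrank_leqif_sup (addsmxSl B v))) in le.
by apply: submx_trans le; apply: addsmxSr.
Qed.

(** * The embedding dimension as a matrix rank *)

Section LinearSpan.
Variables (k : fieldType) (N : nat).
Notation R := {mpoly k[N]}.

Definition linform (v : 'rV[k]_N) : R := \sum_i v 0 i *: 'X_i.

Lemma linform_is_linear : linear linform.
Proof.
move=> a u v; rewrite /linform scaler_sumr -big_split; apply: eq_bigr => i _ /=.
by rewrite !mxE scalerA -scalerDl.
Qed.

HB.instance Definition _ :=
  GRing.isLinear.Build k 'rV[k]_N R *:%R linform linform_is_linear.

Lemma linformK : cancel linform (@coefvec k N).
Proof.
move=> v; rewrite linear_sum /= [RHS]row_sum_delta; apply: eq_bigr => i _.
by rewrite linearZ /= coefvecX.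
Qed.

Lemma linear_partE f : linear_part f = linform (coefvec f).
Proof.
elim/mpolyind: f => [|c m p _ _ IH]; first by rewrite /linear_part !linear0.
rewrite /linear_part linearP /= -/(linear_part p) IH linearP /= [RHS]linearP.
congr (_ *: _ + _); rewrite pihomogX; case: ifP => [/mdeg1P[i /eqP ->]|m1].
  rewrite coefvecX /= /linform (bigD1 i) //= mxE !eqxx scale1r big1 ?addr0 // => j ji.
  by rewrite mxE (negbTE ji) andbF scale0r.
rewrite (_ : coefvec _ = 0) ?linear0 //; apply/rowP => i; rewrite !mxE mcoeffX.
by case: eqP => // mi; move: m1; rewrite mi /= mdeg1 eqxx.
Qed.

Variables (A : set R) (B : 'M[k]_N).
Hypothesis AB : forall v, (exists2 f, A f & coefvec f = v) <-> (v <= B)%MS.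

Lemma lin_spanE p :
  lin_span (@linear_part k N @` A) p <-> exists2 v, (v <= B)%MS & p = linform v.
Proof.
split=> [Sp|[v /AB[f Af <-] ->] W W0 Wl]; last first.
  by move=> /(_ (linform (coefvec f))); apply; exists f => //; rewrite linear_partE.
apply: (Sp [set p | exists2 v, (v <= B)%MS & p = linform v]).
- by exists 0; rewrite ?sub0mx ?linear0.
- move=> a u w [x xB ->] [y yB ->]; exists (a *: x + y); last by rewrite linearP.
  by rewrite addmx_sub ?scalemx_sub.
- move=> _ [f Af <-]; exists (coefvec f); last exact: linear_partE.
  by apply/AB; exists f.
Qed.

Lemma linform_comb r (c : {ffun 'I_r -> k}) (U : 'M[k]_(r, N)) :
  \sum_i c i *: linform (row i U) = linform ((\row_i c i) *m U).
Proof.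
rewrite mulmx_sum_row linear_sum; apply: eq_bigr => i _.
by rewrite linearZ /= mxE.
Qed.

Lemma has_dim_lin_span r :
  has_dim (lin_span (@linear_part k N @` A)) r <-> r = \rank B.
Proof.
have inj := can_inj linformK.
split=> [[b [bS bu]]|->].
  have /choice[u ub] : forall i, exists v, (v <= B)%MS /\ b i = linform v.
    by move=> i; have /lin_spanE[v] := bS i; exists v.
  pose U := \matrix_i u i.
  have bE i : b i = linform (row i U) by rewrite rowK; case: (ub i).
  have comb (c : {ffun 'I_r -> k}) : \sum_i c i *: b i = linform ((\row_i c i) *m U).
    by rewrite -linform_comb; apply: eq_bigr => i _; rewrite bE.
  have free : row_free U.
    rewrite -kermx_eq0; apply/rowV0P => x /sub_kermxP xU.
    have S0 : lin_span (@linear_part k N @` A) 0 by move=> W.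
    have [c [_ cu]] := bu 0 S0.
    have c0 : c = [ffun=> 0].
      apply: cu; rewrite comb (_ : \row_i _ = 0) ?mul0mx ?linear0 //.
      by apply/rowP => i; rewrite !mxE ffunE.
    have cx : c = [ffun i => x 0 i].
      apply: cu; rewrite comb (_ : \row_i _ = x) ?xU ?linear0 //.
      by apply/rowP => i; rewrite !mxE ffunE.
    by apply/rowP => i; move: cx; rewrite c0 => /ffunP/(_ i); rewrite !ffunE mxE.
  have UB : (U <= B)%MS by apply/row_subP => i; rewrite rowK; case: (ub i).
  have BU : (B <= U)%MS.
    apply/row_subP => i; have /bu[c [+ _]] : lin_span (@linear_part k N @` A) (linform (row i B)).
      by apply/lin_spanE; exists (row i B); rewrite ?row_sub.
    by rewrite comb => /inj ->; apply: submxMl.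
  by move: free; rewrite /row_free => /eqP <-; apply/eqP; rewrite eqn_leq !mxrankS.
exists (fun i => linform (row i (row_base B))); split=> [i|p /lin_spanE[v vB ->]].
  by apply/lin_spanE; exists (row i (row_base B)); rewrite // -(eq_row_base B) row_sub.
move: vB; rewrite -(eq_row_base B) => /submxP[x ->].
exists [ffun i => x 0 i]; split=> [|c].
  by rewrite linform_comb; congr (linform (_ *m _)); apply/rowP => i; rewrite mxE ffunE.
rewrite linform_comb => /inj /(row_free_inj (row_base_free B)) ->.
by apply/ffunP => i; rewrite ffunE mxE.
Qed.

(** The cokernel matrix of B represents the quotient of the space of linear forms
    by L(A), so its rank is the embedding dimension. *)
Lemma emb_dimE d : emb_dim A d <-> d = \rank (cokermx B).
Proof.
have le := rank_leq_row B; rewrite mxrank_coker; split=> [[r /has_dim_lin_span -> dN]|->].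
  by apply/eqP; rewrite -(eqn_add2r (\rank B)) dN subnK.
by exists (\rank B); [apply/has_dim_lin_span|rewrite subnK].
Qed.

End LinearSpan.

(** * Gradings by an abelian group *)

Section Grading.
Variables (k : fieldType) (N : nat) (G : zmodType) (w : 'I_N -> G).
Notation R := {mpoly k[N]}.
Implicit Types (f : R) (g : G) (m : 'X_{1..N}) (S : set R).

Definition mweight m : G := \sum_i w i *+ m i.

Lemma mweight0 : mweight 0%MM = 0.
Proof. by apply: big1 => i _; rewrite mnm0E. Qed.

Lemma mweightD m m' : mweight (m + m') = mweight m + mweight m'.
Proof.
by rewrite /mweight -big_split; apply: eq_bigr => i _; rewrite mnmDE mulrnDr.
Qed.

Lemma mweight1 i : mweight U_(i) = w i.
Proof.
rewrite /mweight (bigD1 i) //= mnm1E eqxx big1 ?addr0 // => j ji.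
by rewrite mnm1E eq_sym (negbTE ji).
Qed.

Definition whomog g f := forall m, m \in msupp f -> mweight m = g.

Lemma whomog0 g : whomog g 0.
Proof. by move=> m; rewrite msupp0. Qed.

Lemma whomog1 : whomog 0 1.
Proof. by move=> m; rewrite msupp1 inE => /eqP ->; rewrite mweight0. Qed.

Lemma whomogX i : whomog (w i) 'X_i.
Proof. by move=> m; rewrite msuppX inE => /eqP ->; rewrite mweight1. Qed.

Lemma whomogD g f f' : whomog g f -> whomog g f' -> whomog g (f + f').
Proof. by move=> hf hf' m /msuppD_le; rewrite mem_cat => /orP[/hf|/hf']. Qed.

Lemma whomogB g f f' : whomog g f -> whomog g f' -> whomog g (f - f').
Proof. by move=> hf hf' m /msuppB_le; rewrite mem_cat => /orP[/hf|/hf']. Qed.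

Lemma whomogM g g' f f' : whomog g f -> whomog g' f' -> whomog (g + g') (f * f').
Proof.
move=> hf hf' m /msuppM_le/allpairsP[[u v] /= [/hf ug /hf' vg ->]].
by rewrite mweightD ug vg.
Qed.

Definition wcomp g f : R := \sum_(m <- msupp f | mweight m == g) f@_m *: 'X_[m].

Lemma mcoeff_wcomp g f m : (wcomp g f)@_m = if mweight m == g then f@_m else 0.
Proof.
rewrite raddf_sum /=; have [mf|mf] := boolP (m \in msupp f); last first.
  rewrite memN_msupp_eq0 // if_same big_seq_cond big1 // => m' /andP[m'f _].
  by rewrite mcoeffZ mcoeffX; case: eqP m'f mf => [->->//|_ _ _]; rewrite mulr0.
rewrite -big_filter; case: ifP => mg.
  rewrite (bigD1_seq m) ?filter_uniq ?msupp_uniq ?mem_filter ?mg //=.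
  rewrite mcoeffZ mcoeffX eqxx mulr1 big1 ?addr0 // => m' m'm.
  by rewrite mcoeffZ mcoeffX (negbTE m'm) mulr0.
rewrite big_filter big1 // => m' /eqP m'g; rewrite mcoeffZ mcoeffX.
by case: eqP => [m'm|_]; rewrite ?mulr0 //; rewrite -m'm m'g eqxx in mg.
Qed.

Lemma wcomp_whomog g f : whomog g (wcomp g f).
Proof.
by move=> m; rewrite mcoeff_msupp mcoeff_wcomp; case: ifP => [/eqP //|_]; rewrite eqxx.
Qed.

Lemma wcompD g f f' : wcomp g (f + f') = wcomp g f + wcomp g f'.
Proof.
apply/mpolyP => m; rewrite mcoeffD !mcoeff_wcomp mcoeffD.
by case: ifP => _; rewrite ?addr0.
Qed.

Lemma wcompZ g c f : wcomp g (c *: f) = c *: wcomp g f.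
Proof.
by apply/mpolyP => m; rewrite mcoeffZ !mcoeff_wcomp mcoeffZ; case: ifP => _; rewrite ?mulr0.
Qed.

Lemma wcompMX g f m : wcomp g (f * 'X_[m]) = wcomp (g - mweight m) f * 'X_[m].
Proof.
apply/mpolyP => m'; rewrite mcoeff_wcomp.
have [mm'|mm'] := boolP (m <= m')%MM.
  rewrite -(submK mm') addmC !mcoeffMX mcoeff_wcomp mweightD.
  by rewrite [_ == g - _]eq_sym subr_eq [g == _]eq_sym [mweight m + _]addrC.
have z (p : R) : (p * 'X_[m])@_m' = 0.
  apply: memN_msupp_eq0; apply: contra mm'; rewrite (perm_mem (msuppMX _ _)).
  by case/mapP => u _ ->; apply: lem_addr.
by rewrite !z if_same.
Qed.

Lemma wcomp_id g f : whomog g f -> wcomp g f = f.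
Proof.
move=> fg; apply/mpolyP => m; rewrite mcoeff_wcomp; case: eqP => // mg.
by rewrite memN_msupp_eq0 //; apply/negP => /fg.
Qed.

Lemma wcomp_ne g g' f : whomog g f -> g != g' -> wcomp g' f = 0.
Proof.
move=> fg gg'; apply/mpolyP => m; rewrite mcoeff_wcomp mcoeff0; case: eqP => // mg.
by rewrite memN_msupp_eq0 //; apply: contra gg' => /fg <-; apply/eqP.
Qed.

(** The polynomials all of whose components lie in the ideal form an ideal
    themselves: multiplication by a monomial only shifts the weights. *)
Lemma wcomp_ideal_gen S g f :
  (forall p, S p -> exists g, whomog g p) ->
  ideal_gen S f -> ideal_gen S (wcomp g f).
Proof.
move=> Sh Sf; have [I0 ID IM] := ideal_gen_ideal S.
apply: (Sf [set f | forall g, ideal_gen S (wcomp g f)]); last first.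
- move=> p Sp g' /=; have [h ph] := Sh p Sp; have [E|ne] := eqVneq h g'.
    by rewrite -E wcomp_id // => I II; apply.
  by rewrite (wcomp_ne ph ne).
- split=> [h|x y xS yS h|a x xS] /=.
  + by rewrite wcomp_id //; apply: whomog0.
  + by rewrite wcompD; apply: ID.
  + elim/mpolyind: a => [h|c m p _ _ IH h].
      by rewrite mul0r wcomp_id //; apply: whomog0.
    rewrite mulrDl wcompD; apply: ID; last exact: IH.
    rewrite -scalerAl wcompZ [_ * x]mulrC wcompMX -mul_mpolyC mulrA mulrAC; apply: IM.
    exact: xS.
Qed.

End Grading.

(** * Elimination of the parameters that occur linearly *)

Section Elimination.
Variables (k : fieldType) (N : nat) (G : zmodType) (w : 'I_N -> G) (pos : G -> Prop).
Hypothesis posD : forall a b, pos a -> pos b -> pos (a + b).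
Hypothesis pos0 : ~ pos 0.
Hypothesis posw : forall i, pos (w i).
Notation R := {mpoly k[N]}.
Variable A : set R.
Hypothesis AI : is_ideal A.
Hypothesis A0 : forall f, A f -> at0 f = 0.
Hypothesis Aw : forall g f, A f -> A (wcomp w g f).

Lemma pos_or0_mweight m : mweight w m = 0 \/ pos (mweight w m).
Proof.
have p0D a b : a = 0 \/ pos a -> b = 0 \/ pos b -> a + b = 0 \/ pos (a + b).
  move=> [->|pa] [->|pb]; rewrite ?addr0 ?add0r; [by left|by right|by right|].
  by right; apply: posD.
apply: (big_ind (fun a => a = 0 \/ pos a)) => [||i _]; [by left|exact: p0D|].
by elim: (m i) => [|j IH]; [left|rewrite mulrS; apply: p0D IH; right].
Qed.

Lemma pos_mweight (m : 'X_{1..N}) : m != 0%MM -> pos (mweight w m).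
Proof.
move=> m0; have [i mi] : exists i, (0 < m i)%N.
  apply: contrapT => /forallNP z; case/eqP: m0; apply/mnmP => i.
  by rewrite mnm0E; apply/eqP; rewrite -leqn0 leqNgt; apply/negP/z.
have -> : m = ((m - U_(i)) + U_(i))%MM.
  rewrite submK //; apply/mnm_lepP => j; rewrite mnm1E.
  by case: eqP => // <-.
rewrite mweightD mweight1 addrC; case: (pos_or0_mweight (m - U_(i))%MM) => [->|].
  by rewrite addr0.
exact: posD.
Qed.

Lemma ideal_coefvec_rowspace :
  exists B : 'M[k]_N, forall v, (exists2 f, A f & coefvec f = v) <-> (v <= B)%MS.
Proof.
have [I0 ID IM] := AI.
apply: (@linear_set_rowspace _ _ (fun v => exists2 f, A f & coefvec f = v)).
  by exists 0; rewrite ?linear0.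
move=> a _ _ [f Af <-] [g Ag <-]; exists (a *: f + g); last by rewrite linearP.
by rewrite -mul_mpolyC; apply: ID => //; apply: IM.
Qed.

Variable B : 'M[k]_N.
Hypothesis AB : forall v, (exists2 f, A f & coefvec f = v) <-> (v <= B)%MS.
(* sel selects variables whose classes form a basis of the linear forms modulo
   L(A): the corresponding rows of Q = cokermx B are a basis of its row space. *)
Let Q := cokermx B.
Let e := \rank Q.
Let sel : 'I_e -> 'I_N := maxrankfun Q.

Definition elim_map (q : {mpoly k[e]}) : quotient A :=
  quot_proj A (q \mPo [tuple 'X_(sel j) | j < e]).

HB.instance Definition _ :=
  GRing.RMorphism.copy elim_map (quot_proj A \o comp_mpoly [tuple 'X_(sel j) | j < e]).

Lemma elim_mapE q :
  elim_map q = quot_proj A (q \mPo [tuple 'X_(sel j) | j < e]).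
Proof. by []. Qed.

Lemma quot_proj0 f : quot_proj A f = 0 <-> A f.
Proof. by rewrite quot_proj_eq0 ideal_gen_id. Qed.

Lemma elim_mapX j : elim_map 'X_j = quot_proj A 'X_(sel j).
Proof. by rewrite elim_mapE comp_mpolyXU -tnth_nth tnth_mktuple. Qed.

Lemma elim_mapC c : elim_map c%:MP = quot_proj A c%:MP.
Proof. by rewrite elim_mapE comp_mpolyC. Qed.

Let im f := exists q, quot_proj A f = elim_map q.

Lemma im_sum (T : eqType) (r : seq T) (F : T -> R) :
  (forall t, t \in r -> im (F t)) -> im (\sum_(t <- r) F t).
Proof.
move=> imF; rewrite big_seq; elim/big_ind: _ => [|x y [p px] [q qy]|//].
  by exists 0; rewrite !rmorph0.
by exists (p + q); rewrite !rmorphD /= px qy.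
Qed.

Lemma imZ c f : im f -> im (c *: f).
Proof.
by move=> [q fq]; exists (c *: q); rewrite -!mul_mpolyC !rmorphM /= fq elim_mapC.
Qed.

Lemma imX (m : 'X_{1..N}) : (forall i, m i != 0%N -> im 'X_i) -> im 'X_[m].
Proof.
move=> mi; rewrite mpolyXE_id; elim/big_ind: _ => [|x y [p px] [q qy]|i _].
- by exists 1; rewrite !rmorph1.
- by exists (p * q); rewrite !rmorphM /= px qy.
have [->|/mi[q Xq]] := eqVneq (m i) 0%N; first by exists 1; rewrite !rmorph1.
by exists (q ^+ m i); rewrite !rmorphXn /= Xq.
Qed.

Lemma mdeg_cases (m : 'X_{1..N}) : [\/ m = 0%MM, exists i, m = U_(i)%MM | (1 < mdeg m)%N].
Proof.
case: (ltngtP (mdeg m) 1) => [||/eqP/mdeg1P[i /eqP ->]].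
- by rewrite ltnS leqn0 mdeg_eq0 => /eqP ->; constructor 1.
- by constructor 3.
- by constructor 2; exists i.
Qed.

(** By induction on the weight.  Modulo the selected variables, v is the linear
    part of some F in A; only the component of F of the weight of v matters, and
    its monomials of degree at least two are products of variables of smaller
    weight, because the complementary factor has positive weight. *)
Lemma elim_var v : im 'X_v.
Proof.
(* Induction on the number of variables of smaller weight stands in for
   well-foundedness of the order on weights, of which only finitely many occur. *)
have [c] := ubnP #|[pred u | `[< pos (w v - w u) >]]|.
elim: c v => // c IH v; rewrite ltnS => card_v.
have IHu u : pos (w v - w u) -> im 'X_u.
  move=> vu; apply: IH; apply: leq_trans card_v; apply: proper_card.
  apply/properP; split.
    apply/fintype.subsetP => t /asboolP ut; apply/asboolP.
    by rewrite -(subrK (w u) (w v)) -addrA; apply: posD.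
  by exists u; apply/asboolP => //; rewrite subrr.
have /submxP[x Ex] : (row v Q <= rowsub sel Q)%MS by rewrite eq_maxrowsub row_sub.
pose l : 'rV_N := delta_mx 0 v - x *m rowsub sel 1%:M.
have /AB[F0 AF0 F0l] : (l <= B)%MS.
  rewrite submxE mulmxBl -rowE -mulmxA -/Q Ex.
  by rewrite -rowsubE subrr.
pose F := wcomp w (w v) F0; have AF : A F by apply: Aw.
have -> : 'X_v = F + ('X_v - F) by rewrite addrC subrK.
suff [q Eq] : im ('X_v - F).
  by exists q; rewrite rmorphD /= Eq (_ : quot_proj A F = 0) ?add0r //; apply/quot_proj0.
rewrite [X in im X]mpolyE; apply: im_sum => m; rewrite mcoeff_msupp => m0.
apply: imZ; case: (mdeg_cases m) m0 => [->|[i ->]|m2].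
- by rewrite mcoeffB -!meval_at0 at0X (A0 AF) subrr eqxx.
- have [[j <-] _|nsel] := EM (exists j, sel j = i).
    by exists 'X_j; rewrite elim_mapX.
  rewrite mcoeffB mcoeffXU mcoeff_wcomp mweight1.
  have -> : F0@_U_(i) = l 0 i by rewrite -F0l mxE.
  rewrite !mxE eqxx /= big1 ?subr0 => [|j _]; last first.
    rewrite !mxE; case: eqP => [E|_]; last by rewrite mulr0.
    by case: nsel; exists j.
  by case: (eqVneq i v) => [->|]; rewrite ?eqxx ?subrr ?eqxx // if_same subr0 eqxx.
- have -> : ('X_v - F)@_m = - F@_m.
    rewrite mcoeffB mcoeffX; case: eqP => [E|_]; last by rewrite sub0r.
    by move: m2; rewrite -E mdeg1.
  rewrite oppr_eq0 -mcoeff_msupp => /wcomp_whomog mv.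
  apply: imX => i mi; apply: IHu.
  have le : (U_(i) <= m)%MM.
    by apply/mnm_lepP => j; rewrite mnm1E; case: eqP => // <-; rewrite lt0n.
  rewrite -mv -(submK le) mweightD mweight1 addrK; apply: pos_mweight.
  apply: contraL m2 => /eqP E; rewrite -(submK le) E add0m mdeg1 //.
Qed.

Lemma elim_map_surj y : exists q, elim_map q = y.
Proof.
have [f <-] := quot_proj_surj y.
suff [q E] : im f by exists q.
rewrite [f]mpolyE; apply: im_sum => m _; apply: imZ; apply: imX => i _.
exact: elim_var.
Qed.

Lemma at0_comp (q : {mpoly k[e]}) : at0 (q \mPo [tuple 'X_(sel j) | j < e]) = at0 q.
Proof.
by rewrite comp_mpoly_meval; apply: meval_eq => j; rewrite tnth_mktuple mevalXU.
Qed.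

Lemma coefvec_comp (q : {mpoly k[e]}) : coefvec (q \mPo [tuple 'X_(sel j) | j < e]) =
  coefvec q *m rowsub sel 1%:M.
Proof.
elim/mpoly_alg_ind: q => [c|j|p q IHp IHq|p q IHp IHq].
- by rewrite comp_mpolyC !coefvecC mul0mx.
- rewrite comp_mpolyXU -tnth_nth tnth_mktuple !coefvecX -rowE.
  by apply/rowP => i; rewrite !mxE eqxx /= eq_sym.
- by rewrite comp_mpolyD !linearD /= IHp IHq mulmxDl.
- rewrite rmorphM /= !coefvecM IHp IHq !at0_comp.
  by rewrite mulmxDl !scalemxAl.
Qed.

(** A relation among the selected variables is an element of A, so its linear part
    lies in L(A), where the selected variables are independent. *)
Lemma elim_map_ker q : elim_map q = 0 -> at0 q = 0 /\ coefvec q = 0.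
Proof.
rewrite elim_mapE => /quot_proj0 Aq; split; first by rewrite -at0_comp; apply: A0.
have /AB : exists2 f, A f & coefvec f = coefvec q *m rowsub sel 1%:M.
  by exists (q \mPo [tuple 'X_(sel j) | j < e]) => //; rewrite coefvec_comp.
rewrite submxE -mulmxA -/Q -rowsubE => /eqP E.
by apply: (row_free_inj (maxrowsub_free Q)); rewrite E mul0mx.
Qed.

Lemma origin_ideal_elim_map q : origin_ideal (elim_map q) <-> at0 q = 0.
Proof.
split=> [[f /= f0 E]|q0]; last first.
  by exists (q \mPo [tuple 'X_(sel j) | j < e]) => //=; rewrite at0_comp.
have : A (f - (q \mPo [tuple 'X_(sel j) | j < e])).
  by apply/quot_proj0; rewrite rmorphB /= -elim_mapE E subrr.
by move=> /A0; rewrite mevalB f0 at0_comp sub0r => /eqP; rewrite oppr_eq0 => /eqP.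
Qed.

End Elimination.

(** * Quotients presented with relations of order at least two *)

Section Presentation.
Variables (k : fieldType) (N e : nat) (A : set {mpoly k[N]}).
Variable psi : {rmorphism {mpoly k[e]} -> quotient A}.
Hypothesis psi_surj : forall y, exists q, psi q = y.
Hypothesis psiC : forall c, psi c%:MP = quot_proj A c%:MP.
Hypothesis psi_ker : forall q, psi q = 0 -> at0 q = 0 /\ coefvec q = 0.
Hypothesis psi_origin : forall q, origin_ideal (psi q) <-> at0 q = 0.

Lemma inj_iso_affine : (forall q, psi q = 0 -> q = 0) -> iso_affine_space A e.
Proof.
move=> ker0; have inj : injective psi.
  by move=> p q E; apply/eqP; rewrite -subr_eq0; apply/eqP/ker0; rewrite rmorphB E subrr.
have /choice[phi phiK] := psi_surj.
have phiB : zmod_morphism phi by move=> x y; apply: inj; rewrite rmorphB !phiK.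
have phiM : monoid_morphism phi.
  by split=> [|x y]; apply: inj; rewrite ?rmorph1 ?rmorphM !phiK.
pose Phi : {rmorphism quotient A -> {mpoly k[e]}} :=
  HB.pack phi (GRing.isZmodMorphism.Build _ _ phi phiB)
              (GRing.isMonoidMorphism.Build _ _ phi phiM).
exists Phi; split=> [|c]; last by apply: inj; rewrite phiK psiC.
by exists psi => y /=; [rewrite phiK | apply: inj; rewrite phiK].
Qed.

Lemma krull_lt_presentation q : psi q = 0 -> q != 0 ->
  forall d (P : 'I_d.+1 -> set (quotient A)), prime_chain P -> (d < e)%N.
Proof.
move=> q0 qn d P; apply: prime_chain_lt_kernel q0 qn.
exact: surjective_fraction_map.
Qed.

(** The composite g of the presentation with the isomorphism maps k[y_1, ..., y_e]
    onto k[x_1, ..., x_d], so d <= e.  Under g the origin corresponds to a point p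
    with coordinates in k; its ideal is generated by the d elements x_j - p_j and
    requires e generators, so e <= d. *)
Lemma iso_affine_dim d : iso_affine_space A d -> d = e.
Proof.
move=> [phi [[phi' phiK phi'K] phiC]].
pose g : {rmorphism {mpoly k[e]} -> {mpoly k[d]}} := phi \o psi.
have gE q : g q = phi (psi q) by [].
have g_surj y : exists q, g q = y.
  by have [q E] := psi_surj (phi' y); exists q; rewrite gE E.
have gC c : g c%:MP = c%:MP by rewrite gE psiC.
have g_ker q : g q = 0 -> at0 q = 0 /\ coefvec q = 0.
  by rewrite gE -(rmorph0 phi) => /(can_inj phiK)/psi_ker.
apply/eqP; rewrite eqn_leq; apply/andP; split.
  have [P /(prime_chain_preim (surjective_fraction_map g_surj)) Pc] := krull_dim_mpoly_ge k d.
  exact: krull_dim_mpoly_le Pc.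
have /choice[h hX] : forall j : 'I_d, exists q, g q = 'X_j by move=> j; apply: g_surj.
pose p j := at0 (h j).
pose s := [seq 'X_j - (p j)%:MP | j <- enum 'I_d] : seq {mpoly k[d]}.
have szs : size s = d by rewrite size_map size_enum_ord.
rewrite -{}szs; apply: (gens_ge_dim (f := g)) => [y|a|y /mapP[j _ ->]|i].
- have [q <-] := g_surj y; exists 1, q.
  by rewrite meval1 oner_eq0 rmorph1 mulr1.
- by case/g_ker.
- exists 1, (h j - (p j)%:MP); split; rewrite ?meval1 ?oner_eq0 //.
    by rewrite mevalB mevalC subrr.
  by rewrite rmorph1 mulr1 rmorphB hX gC.
have [I0 ID IM] := ideal_gen_ideal [set` s].
(* The elements x_j - p_j generate the ideal of all polynomials vanishing at p. *)
have taylor (f : {mpoly k[d]}) : ideal_gen [set` s] (f - (f.@[p])%:MP).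
  elim/mpoly_alg_ind: f => [c|j|x y xs ys|x y xs ys].
  - by rewrite mevalC subrr.
  - rewrite mevalXU => I II; apply => /=; apply/mapP; exists j => //.
    by rewrite mem_enum.
  - by rewrite mevalD mpolyCD opprD addrACA; apply: ID.
  - rewrite mevalM mpolyCM.
    have -> : x * y - (x.@[p])%:MP * (y.@[p])%:MP =
        y * (x - (x.@[p])%:MP) + (x.@[p])%:MP * (y - (y.@[p])%:MP).
      by rewrite !mulrBr [y * x]mulrC [y * _]mulrC addrA subrK.
    by apply: ID; apply: (IM).
pose J := [set f | exists2 b, at0 b = 0 & g b = f].
have JI : is_ideal J.
  split=> [|_ _ [b b0 <-] [c c0 <-]|a _ [b b0 <-]].
  - by exists 0; rewrite ?meval0 ?rmorph0.
  - by exists (b + c); [rewrite mevalD b0 c0 addr0|rewrite rmorphD].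
  - have [a' <-] := g_surj a; exists (a' * b); last by rewrite rmorphM.
    by rewrite mevalM b0 mulr0.
have sJ : [set` s] `<=` J.
  move=> _ /= /mapP[j _ ->]; exists (h j - (p j)%:MP).
    by rewrite mevalB mevalC subrr.
  by rewrite rmorphB hX gC.
(* The value of g q at p is that of q at the origin: the constant by which they
   could differ would otherwise lie in the image J of the ideal of the origin,
   which contains no nonzero constant since the kernel has none. *)
have at0g (q : {mpoly k[e]}) : (g q).@[p] = at0 q.
  have [b b0 gb] := taylor (g q) J JI sJ.
  have /g_ker[+ _] : g (b - q + ((g q).@[p])%:MP) = 0.
    by rewrite rmorphD rmorphB gb gC [_ - _ - _]addrAC subrr add0r addNr.
  by rewrite mevalD mevalB b0 mevalC sub0r addrC => /subr0_eq.
have := taylor (g 'X_i); rewrite at0g at0X mpolyC0 subr0; apply.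
Qed.

Lemma iso_affine_krull d : iso_affine_space A d -> krull_dim (quotient A) d.
Proof.
move=> iso; split=> [|n P /(prime_chain_preim (surjective_fraction_map psi_surj))].
  have [phi [[phi' phiK phi'K] _]] := iso.
  have [P Pc] := krull_dim_mpoly_ge k d.
  exists (fun i => phi @^-1` P i); apply: prime_chain_preim Pc.
  by apply: surjective_fraction_map => y; exists (phi' y).
by rewrite (iso_affine_dim iso); apply: krull_dim_mpoly_le.
Qed.

(** This extension of the ideal of the origin is identified as the maximal ideal
    of any localization there, so that uniqueness of the maximal ideal of a
    regular local ring applies to it. *)
Lemma origin_localization_ideal (L : comPzRingType) (f : {rmorphism quotient A -> L}) :
  is_localization_at (@origin_ideal k N A) f ->
  is_maximal [set y | exists a s, [/\ origin_ideal a, ~ origin_ideal s & y * f s = f a]].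
Proof.
move=> [unit frac ker].
have [OI O1 OM] : is_prime (@origin_ideal k N A).
  split; first split.
  - by rewrite -(rmorph0 psi); apply/psi_origin; rewrite meval0.
  - move=> x y; have [p <-] := psi_surj x; have [q <-] := psi_surj y.
    rewrite -rmorphD !psi_origin mevalD => -> ->; exact: addr0.
  - move=> x y; have [p <-] := psi_surj x; have [q <-] := psi_surj y.
    by rewrite -rmorphM !psi_origin mevalM => ->; rewrite mulr0.
  - rewrite -(rmorph1 psi) psi_origin meval1; apply/eqP; exact: oner_neq0.
  - move=> x y; have [p <-] := psi_surj x; have [q <-] := psi_surj y.
    rewrite -rmorphM !psi_origin mevalM => /eqP; rewrite mulf_eq0.
    by move=> /orP[] /eqP; [left|right].
have [O0 OD OMl] := OI.
split; first split.
- by exists 0, 1; split=> //; rewrite rmorph0 mul0r.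
- move=> x y [a [s [Oa Os xs]]] [b [t [Ob Ot yt]]].
  exists (t * a + s * b), (s * t); split.
  + by apply: OD; apply: (OMl).
  + by case/OM.
  + by rewrite rmorphD !rmorphM -xs -yt mulrDl mulrA [f s * (y * _)]mulrCA [f t * _]mulrC.
- move=> c x [a [s [Oa Os xs]]]; have [b [t [Ot ct]]] := frac c.
  exists (b * a), (t * s); split.
  + exact: OMl.
  + by case/OM.
  + by rewrite !rmorphM -xs -ct mulrACA.
- move=> [a [s [Oa Os]]]; rewrite mul1r => E.
  have /ker[t [Ot]] : f (s - a) = 0 by rewrite rmorphB E subrr.
  rewrite mulrBr => /subr0_eq ts; have /OM[] // : origin_ideal (t * s).
  by rewrite ts; apply: OMl.
- move=> I [I0 ID IM] I1 _ y Iy; have [a [s [Os ys]]] := frac y.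
  exists a, s; split=> //; apply: contrapT => /unit[v fav]; apply: I1.
  by rewrite -fav -ys mulrC; apply: (IM); rewrite mulrC; apply: (IM).
Qed.

(** In the local ring at the origin the dimension is smaller than e, while the
    maximal ideal cannot be generated by fewer than e elements. *)
Lemma presentation_singular q : psi q = 0 -> q != 0 -> origin_singular A.
Proof.
move=> q0 qn [L [f [loc [_ [m [mmax muniq [d [[P Pc] _] [[s ms szs] _]]]]]]]].
have mE := muniq _ (origin_localization_ideal loc).
have [unit frac ker] := loc.
pose g : {rmorphism {mpoly k[e]} -> L} := f \o psi.
have gE p : g p = f (psi p) by [].
have gfrac y : exists w a, at0 w != 0 /\ y * g w = g a.
  have [a [t [Ot yt]]] := frac y.
  have [w E] := psi_surj t; have [b Eb] := psi_surj a; exists w, b.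
  by rewrite !gE E Eb; split=> //; apply: contra_not_neq Ot; rewrite -E psi_origin.
have gunit w : at0 w != 0 -> exists v, g w * v = 1.
  by move=> w0; apply: unit; rewrite psi_origin; apply/eqP.
have lt : (d < e)%N.
  apply: (@prime_chain_lt_kernel _ _ _ g q d P) => //; last by rewrite gE q0 rmorph0.
  by move=> y; have [w [a [/gunit[v wv] E]]] := gfrac y; exists w, a, v.
have : (e <= size s)%N; last by rewrite szs leqNgt lt.
apply: (gens_ge_dim (f := g)) => // [a|y ys|i].
- rewrite gE => /ker[t [Ot]]; have [w E] := psi_surj t; rewrite -E -rmorphM => /psi_ker[].
  rewrite mevalM coefvecM => wa0.
  have w0 : at0 w != 0 by apply: contra_not_neq Ot; rewrite -E psi_origin.
  move/eqP: wa0; rewrite mulf_eq0 (negbTE w0) /= => /eqP ->.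
  by rewrite scale0r addr0 => /eqP; rewrite scaler_eq0 (negbTE w0) /= => /eqP.
- have : m y by rewrite ms => I _; apply.
  rewrite -mE => -[a [t [Oa Ot E]]].
  have [w Ew] := psi_surj t; have [b Eb] := psi_surj a; exists w, b.
  rewrite !gE Ew Eb; split=> //; last by apply/psi_origin; rewrite Eb.
  by apply: contra_not_neq Ot; rewrite -Ew psi_origin.
- rewrite -ms -mE; exists (psi 'X_i), 1; split; last by rewrite rmorph1 mulr1.
  + by apply/psi_origin; rewrite at0X.
  + by rewrite -(rmorph1 psi) psi_origin meval1; apply/eqP; exact: oner_neq0.
Qed.

End Presentation.

(** The statement for strata, for an arbitrary homogeneous ideal through the
    origin.  Positivity of weights is expressed by a subset of the grading group
    closed under addition and avoiding zero, which the term order provides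
    directly and which is all that the elimination needs. *)
Theorem graded_affine_or_singular (k : fieldType) N (G : zmodType) (w : 'I_N -> G)
    (pos : G -> Prop) (A : set {mpoly k[N]}) :
  (forall a b, pos a -> pos b -> pos (a + b)) -> ~ pos 0 -> (forall i, pos (w i)) ->
  is_ideal A -> (forall f, A f -> at0 f = 0) ->
  (forall g f, A f -> A (wcomp w g f)) ->
  ((exists d, iso_affine_space A d) \/ origin_singular A) /\
  (forall d, iso_affine_space A d <-> emb_dim A d /\ krull_dim (quotient A) d).
Proof.
move=> posD pos0 posw AI A0 Aw.
have [B AB] := ideal_coefvec_rowspace AI.
have surj := elim_map_surj posD pos0 posw AI A0 Aw AB.
have ker := elim_map_ker AI A0 AB.
have orig := origin_ideal_elim_map AI A0 (B := B).
have mapC := @elim_mapC k N A B.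
have edE := emb_dimE AB.
have [ker0|] := EM (forall q : {mpoly k[\rank (cokermx B)]}, elim_map A q = 0 -> q = 0).
  have iso := inj_iso_affine surj mapC ker0.
  split=> [|d]; first by left; exists (\rank (cokermx B)).
  split=> [isod|[/edE -> _]] //; split.
    by apply/edE; apply: (iso_affine_dim surj mapC ker) isod.
  exact: (iso_affine_krull surj mapC ker) isod.
move=> /existsNP[q /not_implyP[q0 /eqP qn]].
split=> [|d]; first by right; apply: presentation_singular q0 qn.
split=> [isod|[/edE -> [[P Pc] _]]].
  split; first by apply/edE; apply: (iso_affine_dim surj mapC ker) isod.
  exact: (iso_affine_krull surj mapC ker) isod.
by have := krull_lt_presentation surj q0 qn Pc; rewrite ltnn.
Qed.

(** * The grading of a stratum *)

Section StratumGrading.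
Variables (k : fieldType) (n s : nat) (prec : rel 'X_{1..n}).
Variables (J : set {mpoly k[n]}) (alpha : 'I_s -> 'X_{1..n}) (K : stratum_kind n s).
Hypothesis prec_order : term_order prec.
Hypothesis adm : admissible prec K.
Let C := stratum_var prec J alpha K.
Let F := @generic_gen k n prec J s alpha K.
Notation kCX := {mpoly {mpoly k[nvars prec J alpha K]}[n]}.

Definition mvec (m : 'X_{1..n}) : {ffun 'I_n -> int} := [ffun i => Posz (m i)].

Lemma mvecD m m' : mvec (m + m') = mvec m + mvec m'.
Proof. by apply/ffunP => i; rewrite !ffunE mnmDE PoszD. Qed.

Lemma mvec_inj : injective mvec.
Proof. by move=> m m' /ffunP E; apply/mnmP => i; have := E i; rewrite !ffunE => -[]. Qed.

(** The cone of positive vectors of the term order, extended from monomials to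
    their differences. *)
Definition term_pos (g : {ffun 'I_n -> int}) :=
  exists a b, prec b a /\ g = mvec a - mvec b.

Lemma term_posD g g' : term_pos g -> term_pos g' -> term_pos (g + g').
Proof.
have [_ trans _ addm _] := prec_order.
move=> [a [b [ba ->]]] [a' [b' [ba' ->]]]; exists (a + a')%MM, (b + b')%MM; split.
  apply: (trans (a + b')%MM); first exact: addm.
  by rewrite ![(a + _)%MM]addmC; apply: addm.
by rewrite !mvecD opprD addrACA.
Qed.

Lemma term_pos0 : ~ term_pos 0.
Proof.
have [irr _ _ _ _] := prec_order.
by move=> [a [b [+ /esym /subr0_eq /mvec_inj E]]]; rewrite E irr.
Qed.

Definition var_weight (v : 'I_(nvars prec J alpha K)) : {ffun 'I_n -> int} :=
  let x : C := enum_val v in mvec (alpha (tag x)) - mvec (val (tagged x)).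

Lemma tail_set_prec i b : tail_set prec J alpha K i b -> prec b (alpha i).
Proof. by rewrite /tail_set; case: K => [||tau] /= [] // []. Qed.

Lemma var_weight_pos v : term_pos (var_weight v).
Proof.
exists (alpha (tag (enum_val v : C))), (val (tagged (enum_val v : C))); split=> //.
case: (enum_val v : C) => i b /=.
have : val b \in fset_set (tail_set prec J alpha K i) by apply: valP.
rewrite in_fset_set; last exact: finite_tail_set.
by move=> /set_mem /tail_set_prec.
Qed.

(** Homogeneity in k[C][X] for the grading that also gives x_j the weight e_j. *)
Definition xhomog g (h : kCX) := forall m, whomog var_weight (g - mvec m) h@_m.

Lemma xhomogB g h h' : xhomog g h -> xhomog g h' -> xhomog g (h - h').
Proof. by move=> hg hg' m; rewrite mcoeffB; apply: whomogB. Qed.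

Lemma xhomogD g h h' : xhomog g h -> xhomog g h' -> xhomog g (h + h').
Proof. by move=> hg hg' m; rewrite mcoeffD; apply: whomogD. Qed.

Lemma xhomogM g g' h h' : xhomog g h -> xhomog g' h' -> xhomog (g + g') (h * h').
Proof.
move=> hg hg' m; rewrite mcoeffM.
elim/big_ind: _ => [|x y|u /eqP E]; [exact: whomog0 | exact: whomogD |].
by rewrite (congr1 mvec E) mvecD opprD addrACA; apply: whomogM.
Qed.

Lemma xhomogZX g c m : whomog var_weight g c -> xhomog (g + mvec m) (c *: 'X_[m]).
Proof.
move=> cg m'; rewrite mcoeffZ mcoeffX; case: eqP => [->|_].
  by rewrite mulr1 addrK.
by rewrite mulr0; apply: whomog0.
Qed.

Lemma xhomogX m : xhomog (mvec m) 'X_[m].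
Proof.
by rewrite -[mvec m]add0r -['X_[m]]scale1r; apply: xhomogZX; apply: whomog1.
Qed.

Lemma generic_gen_xhomog i : xhomog (mvec (alpha i)) (F i).
Proof.
apply: xhomogD; first exact: xhomogX.
elim/big_ind: _ => [m||b _].
- by rewrite mcoeff0; apply: whomog0.
- exact: xhomogD.
rewrite -[X in xhomog X](subrK (mvec (val b))); apply: xhomogZX.
have := @whomogX k _ _ var_weight
  (enum_rank (Tagged (fun i => fset_set (tail_set prec J alpha K i)) b : C)).
by rewrite /var_weight enum_rankK.
Qed.

Definition vanishing (h : kCX) := forall m, at0 (h@_m) = 0.

Lemma vanishingD h h' : vanishing h -> vanishing h' -> vanishing (h + h').
Proof. by move=> v v' m; rewrite mcoeffD mevalD v v' addr0. Qed.

Lemma vanishingM h h' : vanishing h -> vanishing (h * h').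
Proof.
move=> v m; rewrite mcoeffM raddf_sum big1 // => u _ /=.
by rewrite mevalM v mul0r.
Qed.

Lemma vanishingN h : vanishing h -> vanishing (- h).
Proof. by move=> v m; rewrite mcoeffN mevalN v oppr0. Qed.

Lemma generic_gen_vanishing i : vanishing (F i - 'X_[alpha i]).
Proof.
rewrite /F /generic_gen addrAC subrr add0r => m.
rewrite raddf_sum raddf_sum big1 // => b _ /=.
by rewrite mcoeffZ mevalM at0X mul0r.
Qed.

Lemma spoly_xhomog i j :
  exists g, xhomog g (spoly prec J alpha K i j).
Proof.
set l := mlcm (alpha i) (alpha j); exists (mvec l).
have le t : (alpha t <= l)%MM ->
    xhomog (mvec l) ('X_[(l - alpha t)%MM] * (F t : kCX)).
  move=> le; rewrite -{1}(submK le) mvecD; apply: xhomogM; first exact: xhomogX.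
  exact: generic_gen_xhomog.
by apply: xhomogB; apply: le; [apply: lem_mlcml|apply: lem_mlcmr].
Qed.

Lemma spoly_vanishing i j : vanishing (spoly prec J alpha K i j).
Proof.
rewrite /spoly; set l := mlcm _ _.
have E t : (alpha t <= l)%MM -> 'X_[(l - alpha t)%MM] * F t =
    'X_[l] + (F t - 'X_[alpha t]) * 'X_[(l - alpha t)%MM].
  by move=> le; rewrite mulrBl -mpolyXD [(alpha t + _)%MM]addmC submK // addrC subrK mulrC.
rewrite -!/(F _) !E ?lem_mlcml ?lem_mlcmr // opprD addrACA subrr add0r.
apply: vanishingD; last apply: vanishingN;
  by apply: vanishingM; apply: generic_gen_vanishing.
Qed.

(** A reduction step subtracts a multiple of a homogeneous generator by the
    coefficient of the monomial cancelled: its weight is the same, and its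
    coefficient already vanishes at the origin. *)
Lemma reduces_invariant g h h' : xhomog g h -> vanishing h ->
  @reduces k n prec J s alpha K h h' -> xhomog g h' /\ vanishing h'.
Proof.
move=> hg hv; elim=> [//|{}h' m i _ [hg' hv'] _ le]; split.
  apply: xhomogB => //.
  have -> : g = (g - mvec m + mvec (m - alpha i)%MM) + mvec (alpha i).
    by rewrite -addrA -mvecD submK // subrK.
  apply: xhomogM; last exact: generic_gen_xhomog.
  exact: xhomogZX.
apply: vanishingD => //; apply: vanishingN; apply: vanishingM => m'.
by rewrite mcoeffZ mevalM hv' mul0r.
Qed.

End StratumGrading.

Theorem corollary3p6 (k : fieldType) (n s : nat) (prec : rel 'X_{1..n})
    (J : set {mpoly k[n]}) (alpha : 'I_s -> 'X_{1..n}) (K : stratum_kind n s)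
    (H : 'I_s -> 'I_s -> genpoly prec J alpha K) :
  term_order prec ->
  monomial_ideal J ->
  minimal_generators J alpha ->
  admissible prec K ->
  (forall i j : 'I_s, (i < j)%N ->
     complete_reduction prec J alpha K (spoly prec J alpha K i j) (H i j)) ->
  let A := stratum_ideal prec J alpha K H in
  ((exists d : nat, iso_affine_space A d) \/ origin_singular A) /\
  (forall d : nat, iso_affine_space A d <-> emb_dim A d /\ krull_dim (quotient A) d).
Proof.
move=> prec_order _ _ adm red A.
have coefP (i j : 'I_s) m : (i < j)%N ->
    (exists g, whomog (@var_weight k n s prec J alpha K) g (H i j)@_m) /\
    ((H i j)@_m).@[fun=> 0] = 0.
  move=> /red[redH _]; have [g gh] := spoly_xhomog prec J alpha K i j.
  have [Hg Hv] := reduces_invariant gh (spoly_vanishing prec J alpha K i j) redH.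
  by split; [eexists; apply: Hg | apply: Hv].
apply: (@graded_affine_or_singular _ _ _ (@var_weight k n s prec J alpha K) (term_pos prec)).
- exact: term_posD.
- exact: term_pos0.
- by move=> v; apply: var_weight_pos.
- exact: ideal_gen_ideal.
- move=> f /(_ [set f | f.@[fun=> 0] = 0]); apply.
    split=> [|x y x0 y0|a x x0] /=; first exact: meval0.
      by rewrite mevalD x0 y0 addr0.
    by rewrite mevalM x0 mulr0.
  by move=> _ [i [j [m [ij ->]]]]; case: (coefP i j m ij).
- move=> g f; apply: wcomp_ideal_gen => _ [i [j [m [ij ->]]]].
  by case: (coefP i j m ij).
Qed.
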